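(* Let $x_0\in\mathbb{R}^{N_x}$ have at least one nonzero entry. Suppose that (1) there exists some $\Phi\in\mathbb{R}^{N_\Phi\times N_x}$ that satisfies both $Z_{AB}\Phi=\begin{bmatrix} I\\0\end{bmatrix}$ and $\Phi\in\mathcal{L}$, and (2) $\operatorname{rank}\bigl((X_2)_{:,\mathfrak{M}}(I-H^\dagger H)\bigr)=N_uT$. Then localized MPC attains optimal global performance for the state $x_0$, i.e. $f^*=f^*_{\mathcal{L}}$.
   Context: Fix integers $N_x,N_u,T\ge 1$ and real matrices $A\in\mathbb{R}^{N_x\times N_x}$, $B\in\mathbb{R}^{N_x\times N_u}$, defining the system $x(t+1)=Ax(t)+Bu(t)$. Put $N_\Phi:=N_x(T+1)+N_uT$. Matrix $Z_{AB}$: $Z_{AB}:=\begin{bmatrix} I-Z\hat A & -Z\hat B\end{bmatrix}\in\mathbb{R}^{N_x(T+1)\times N_\Phi}$, where $Z$ is the block-downshift matrix (identity blocks $I_{N_x}$ on the first block sub-diagonal, zeros elsewhere), $\hat A=\operatorname{blkdiag}(A,\dots,A)$, $\hat B=\operatorname{blkdiag}(B,\dots,B)$ with compatible dimensions. Explicitly, applied to a vector $(x_0,\dots,x_T,u_0,\dots,u_{T-1})$ with $x_t\in\mathbb{R}^{N_x}$, $u_t\in\mathbb{R}^{N_u}$, $Z_{AB}$ gives the vector whose block $0$ is $x_0$ and whose block $t$ is $x_t-Ax_{t-1}-Bu_{t-1}$ for $t=1,\dots,T$. The matrix $\begin{bmatrix} I\\0\end{bmatrix}\in\mathbb{R}^{N_x(T+1)\times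 N_x}$ has top block $I_{N_x}$ and zeros below. Decision variable: $\Phi=\begin{bmatrix}\Phi_x\\ \Phi_u\end{bmatrix}\in\mathbb{R}^{N_\Phi\times N_x}$, where $\Phi_x$ has $N_x(T+1)$ rows and $\Phi_u$ has $N_uT$ rows. Locality constraint: $\mathcal{L}\subseteq\mathbb{R}^{N_\Phi\times N_x}$ is the set of all matrices with a prescribed sparsity pattern, i.e. there is a fixed set $S$ of positions $(i,j)$ such that $\Phi\in\mathcal{L}$ iff $(\Phi)_{i,j}=0$ for every $(i,j)\notin S$. MPC problems: let $f(\mathbf{x},\mathbf{u})=\sum_{t=0}^{T-1}f_t(x_t,u_t)+f_T(x_T)$, where the $f_t$ and $f_T$ are closed, proper, convex functions with minimum at the origin, and let $\mathcal{X}=\mathcal{X}_0\times\dots\times\mathcal{X}_T$, $\mathcal{U}=\mathcal{U}_0\times\dots\times\mathcal{U}_{T-1}$ be products of closed convex sets containing the origin. The global MPC problem for state $x_0$ is: minimize $f(\Phi_xx_0,\Phi_ux_0)$ over $\Phi$ subject to $Z_{AB}\Phi=\begin{bmatrix} I\\0\end{bmatrix}$, $\Phi_xx_0\in\mathcal{X}$, $\Phi_ux_0\in\mathcal{U}$; its optimal value is $f^*$. The localized MPC problem is the same problem with the additional constraint $\Phi\in\mathcal{L}$; its optimal value is $f^*_{\mathcal{L}}$. ''Localized MPC attains optimal global performance'' for $x_0$ means $f^*=f^*_{\mathcal{L}}$ (here $f$ is an arbitrary objective of the form $\sum_{t=0}^{T-1}f_t(x_t,u_t)+f_T(x_T)$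 with closed, proper, convex $f_t$, $f_T$ having their minimum at the origin, and $\mathcal{X},\mathcal{U}$ are arbitrary products of closed convex sets containing the origin). Further notation: $M^\dagger$ is the Moore–Penrose pseudoinverse. $(M)_{i:,:}$ denotes the rows of $M$ from the $i$-th on; $(M)_{:,\mathfrak{C}}$ the submatrix of columns indexed by $\mathfrak{C}$. $\vec{M}$ is the column-stacking vectorization. $Z_{AB}^{\mathrm{blk}}:=\operatorname{blkdiag}(Z_{AB},\dots,Z_{AB})$ with $N_x$ copies, so that $\overrightarrow{Z_{AB}\Phi}=Z_{AB}^{\mathrm{blk}}\vec{\Phi}$. $X=X(x_0):=\begin{bmatrix}(x_0)_1I&(x_0)_2I&\cdots&(x_0)_{N_x}I\end{bmatrix}$ with $I=I_{N_\Phi}$, so $\Phi x_0=X\vec{\Phi}$; $X_2:=(X)_{N_x+1:,:}$. $\mathfrak{M}$ (support vector indices) is the set of indices of $\vec{\Phi}$ whose entries are allowed to be nonzero by the constraint $\Phi\in\mathcal{L}$. $H:=(Z_{AB}^{\mathrm{blk}})_{:,\mathfrak{M}}$. *)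

(* Defs.v *)
From HB Require Import structures.
From mathcomp Require Import all_boot all_order all_algebra.
From mathcomp Require Import all_classical all_reals all_analysis.
Set Implicit Arguments.
Unset Strict Implicit.
Unset Printing Implicit Defensive.
Import Order.TTheory GRing.Theory Num.Theory.
Import numFieldNormedType.Exports.
Local Open Scope classical_set_scope.
Local Open Scope ring_scope.

(* Trajectories are stacked with the block matrices of the library, so the
   dimensions Nx(T+1), Nu T and N_Phi appear as sums of constant block sizes. *)
Notation state_dim Nx T := (\sum_(i < T.+1) Nx)%N (only parsing).
Notation input_dim Nu T := (\sum_(i < T) Nu)%N (only parsing).
Notation phi_dim Nx Nu T := (state_dim Nx T + input_dim Nu T)%N (only parsing).

Section PseudoInverse.
Variable R : realType.

(* The four Penrose equations; over the reals the adjoint is the transpose. *)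
Definition penrose m n (M : 'M[R]_(m, n)) (P : 'M[R]_(n, m)) : Prop :=
  [/\ M *m P *m M = M, P *m M *m P = P,
      (M *m P)^T = M *m P & (P *m M)^T = P *m M].

(* The default value 0 is never used: see [penrose_mp_pinv] and [penrose_inj]. *)
Definition mp_pinv m n (M : 'M[R]_(m, n)) : 'M[R]_(n, m) :=
  xget 0 [set P | penrose M P].

Lemma penrose_inj m n (M : 'M[R]_(m, n)) P Q :
  penrose M P -> penrose M Q -> P = Q.
Proof.
move=> [p1 p2 p3 p4] [q1 q2 q3 q4].
have e1 : M *m P = M *m Q.
  rewrite -p3 -[in LHS]q1 -(mulmxA (M *m Q)) trmx_mul p3 q3.
  by rewrite mulmxA p1.
have e2 : P *m M = Q *m M.
  rewrite -p4 -[in LHS]q1 -(mulmxA M Q M) mulmxA trmx_mul p4 q4.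
  by rewrite -mulmxA (mulmxA M) p1.
by rewrite -p2 e2 -mulmxA e1 mulmxA q2.
Qed.

Lemma gram_unit m n (C : 'M[R]_(m, n)) :
  \rank C = n -> C^T *m C \in unitmx.
Proof.
move=> rC; rewrite -row_free_unit -kermx_eq0; apply/eqP/row_matrixP => i.
rewrite row0; set v := row i _.
have vG : v *m (C^T *m C) = 0.
  by apply/sub_kermxP; rewrite /v row_sub.
have w0 : v *m C^T = 0.
  have : (v *m C^T) *m (v *m C^T)^T = 0.
    by rewrite trmx_mul trmxK mulmxA -(mulmxA v) vG mul0mx.
  move=> /matrixP/(_ 0 0); rewrite !mxE => /eqP.
  under eq_bigr do rewrite [X in _ * X]mxE -expr2.
  rewrite psumr_eq0; last by move=> j _; rewrite sqr_ge0.
  move=> /allP sw0; apply/rowP => j; rewrite [RHS]mxE.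
  by have /implyP/(_ isT) := sw0 j (mem_index_enum _); rewrite sqrf_eq0 => /eqP.
have fC : row_free C^T by rewrite /row_free mxrank_tr rC.
by apply: (row_free_inj fC); rewrite w0 mul0mx.
Qed.

Lemma penrose_ex m n (M : 'M[R]_(m, n)) : exists P, penrose M P.
Proof.
have [r [C [F [MCF rC rF]]]] : exists r (C : 'M[R]_(m, r)) (F : 'M[R]_(r, n)),
    [/\ M = C *m F, \rank C = r & \rank F = r].
  exists (\rank M), (col_base M), (row_base M); split; first by rewrite mulmx_base.
    by apply/eqP; exact: col_base_full.
  by apply/eqP; exact: row_base_free.
have uC : C^T *m C \in unitmx by apply: gram_unit.
have uF : F *m F^T \in unitmx.
  by rewrite -{1}[F]trmxK; apply: gram_unit; rewrite mxrank_tr.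
pose L := invmx (C^T *m C) *m C^T; pose K := F^T *m invmx (F *m F^T).
have LC : L *m C = 1%:M by rewrite /L -mulmxA mulVmx.
have FK : F *m K = 1%:M by rewrite /K mulmxA mulmxV.
have MP : M *m (K *m L) = C *m L.
  by rewrite MCF -mulmxA (mulmxA F) FK mul1mx.
have PM : K *m L *m M = K *m F.
  by rewrite MCF -mulmxA (mulmxA L) LC mul1mx.
exists (K *m L); split.
- by rewrite MP MCF mulmxA -(mulmxA C L) LC mulmx1.
- by rewrite PM mulmxA -(mulmxA K F) FK mulmx1.
- by rewrite MP /L !trmx_mul trmxK trmx_inv trmx_mul trmxK mulmxA.
- by rewrite PM /K !trmx_mul trmxK trmx_inv trmx_mul trmxK mulmxA.
Qed.

Lemma penrose_mp_pinv m n (M : 'M[R]_(m, n)) : penrose M (mp_pinv M).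
Proof. by have [P MP] := penrose_ex M; exact: (xgetPex 0 (ex_intro _ P MP)). Qed.

End PseudoInverse.

Section Submatrices.
Variable R : realType.

Lemma rows_from_proof m k (i : 'I_(m - k)) : (k + i < m)%N.
Proof. by rewrite -ltn_subRL. Qed.

(* Rows are counted from 0: [rows_from k M] drops the first [k] rows. *)
Definition rows_from k m n (M : 'M[R]_(m, n)) : 'M[R]_(m - k, n) :=
  rowsub (fun i => Ordinal (rows_from_proof i)) M.

Definition cols_in m n (C : {set 'I_n}) (M : 'M[R]_(m, n)) : 'M[R]_(m, #|C|) :=
  colsub (fun k : 'I_#|C| => enum_val k) M.

Definition vec m n (M : 'M[R]_(m, n)) : 'cV[R]_(\sum_(i < n) m) :=
  \mxcol_(j < n) col j M.

(* [mxdiag] only covers square blocks. *)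
Definition blkdiag k m n (M : 'M[R]_(m, n)) :
    'M[R]_(\sum_(i < k) m, \sum_(i < k) n) :=
  \mxblock_(i < k, j < k) (if i == j then M else 0).

Definition sparse m n (S : {set 'I_m * 'I_n}) : set 'M[R]_(m, n) :=
  [set M | forall i j, (i, j) \notin S -> M i j = 0].

Definition support_idx m n (L : set 'M[R]_(m, n)) : {set 'I_(\sum_(i < n) m)} :=
  [set k | `[< exists2 M, L M & vec M k 0 != 0 >]]%SET.

Lemma blkdiag_vec k m n (M : 'M[R]_(m, n)) (P : 'M[R]_(n, k)) :
  blkdiag k M *m vec P = vec (M *m P).
Proof.
rewrite /blkdiag /vec mxblockEv mxcol_mul; apply/eq_mxcol => i.
rewrite mul_mxrow_mxcol (bigD1 i) //= eqxx big1 ?addr0; last first.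
  by move=> j ji; rewrite eq_sym (negbTE ji) mul0mx.
by apply/colP => a; rewrite !mxE; apply: eq_bigr => b _; rewrite !mxE.
Qed.

End Submatrices.

Section ExtendedConvex.
Variables (R : realType) (V : normedModType R).

Definition epigraph (f : V -> \bar R) : set (V * R^o) :=
  [set p | (f p.1 <= (p.2 : R)%:E)%E].

Definition proper_fun (f : V -> \bar R) : Prop :=
  (forall v, f v != -oo%E) /\ (exists v, f v != +oo%E).

Definition closed_proper_convex (f : V -> \bar R) : Prop :=
  [/\ closed (epigraph f), proper_fun f & convex_set (epigraph f)].

Definition min_at_origin (f : V -> \bar R) : Prop := forall v, (f 0%R <= f v)%E.

End ExtendedConvex.

Section LocalizedMPC.
Variables (R : realType) (Nx Nu T : nat).
Variables (A : 'M[R]_Nx) (B : 'M[R]_(Nx, Nu)).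

Definition downshift : 'M[R]_(state_dim Nx T) :=
  \mxblock_(i < T.+1, j < T.+1) (if i == j.+1 :> nat then 1%:M else 0 : 'M[R]_Nx).

Definition hatA : 'M[R]_(state_dim Nx T) := \mxdiag_(_ < T.+1) A.

(* T diagonal blocks B followed by one zero block row, so that
   [downshift *m hatB] is defined. *)
Definition hatB : 'M[R]_(state_dim Nx T, input_dim Nu T) :=
  \mxblock_(i < T.+1, j < T) (if i == j :> nat then B else 0).

Definition ZAB : 'M[R]_(state_dim Nx T, phi_dim Nx Nu T) :=
  row_mx (1%:M - downshift *m hatA) (- (downshift *m hatB)).

Definition I0 : 'M[R]_(state_dim Nx T, Nx) :=
  \mxcol_(i < T.+1) (if i == ord0 then 1%:M else 0 : 'M[R]_Nx).

Definition ZABblk := blkdiag Nx ZAB.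

Definition Xmat (x0 : 'cV[R]_Nx) :
    'M[R]_(phi_dim Nx Nu T, \sum_(i < Nx) phi_dim Nx Nu T) :=
  \mxrow_(j < Nx) (x0 j 0)%:M.

Definition X2 (x0 : 'cV[R]_Nx) := rows_from Nx (Xmat x0).

Definition Hmat (L : set 'M[R]_(phi_dim Nx Nu T, Nx)) :=
  cols_in (support_idx L) ZABblk.

Definition mpc_cost (ft : 'I_T -> 'cV[R]_Nx * 'cV[R]_Nu -> \bar R)
    (fT : 'cV[R]_Nx -> \bar R)
    (x : 'cV[R]_(state_dim Nx T)) (u : 'cV[R]_(input_dim Nu T)) : \bar R :=
  (\sum_(t < T) ft t (submxcol x (widen_ord (leqnSn T) t), submxcol u t)
   + fT (submxcol x ord_max))%E.

Definition block_product k n (D : 'I_k -> set 'cV[R]_n) :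
    set 'cV[R]_(\sum_(i < k) n) :=
  [set x | forall t, D t (submxcol x t)].

Definition mpc_feasible (XX : 'I_T.+1 -> set 'cV[R]_Nx)
    (UU : 'I_T -> set 'cV[R]_Nu) (x0 : 'cV[R]_Nx) :
    set 'M[R]_(phi_dim Nx Nu T, Nx) :=
  [set Phi | [/\ ZAB *m Phi = I0,
                 block_product XX (usubmx Phi *m x0) &
                 block_product UU (dsubmx Phi *m x0)]].

Definition mpc_value ft fT XX UU x0 : \bar R :=
  ereal_inf [set mpc_cost ft fT (usubmx Phi *m x0) (dsubmx Phi *m x0)
            | Phi in mpc_feasible XX UU x0].

Definition localized_mpc_value ft fT XX UU
    (L : set 'M[R]_(phi_dim Nx Nu T, Nx)) x0 : \bar R :=
  ereal_inf [set mpc_cost ft fT (usubmx Phi *m x0) (dsubmx Phi *m x0)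
            | Phi in mpc_feasible XX UU x0 `&` L].

Lemma Xmat_vec x0 (Phi : 'M[R]_(phi_dim Nx Nu T, Nx)) :
  Xmat x0 *m vec Phi = Phi *m x0.
Proof.
rewrite /Xmat /vec mul_mxrow_mxcol; apply/colP => i; rewrite summxE mxE.
by apply: eq_bigr => j _; rewrite mul_scalar_mx !mxE mulrC.
Qed.

Lemma downshift_block0 n (v : 'M[R]_(state_dim Nx T, n)) :
  submxcol (downshift *m v) ord0 = 0.
Proof.
rewrite -[v]submxcolK /downshift mxblockEv mxcol_mul mxcolK mul_mxrow_mxcol.
by rewrite big1 // => j _ /=; rewrite mul0mx.
Qed.

Lemma downshift_blockS n (v : 'M[R]_(state_dim Nx T, n)) (t : 'I_T) :
  submxcol (downshift *m v) (lift ord0 t) =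
  submxcol v (widen_ord (leqnSn T) t).
Proof.
rewrite -[v]submxcolK /downshift mxblockEv mxcol_mul !mxcolK mul_mxrow_mxcol.
rewrite (bigD1 (widen_ord (leqnSn T) t)) //= eqxx mul1mx big1 ?addr0 // => j jt.
case: eqP => [tj|]; last by rewrite mul0mx.
by case/eqP: jt; apply: val_inj => /=; case: tj.
Qed.

Lemma hatA_block n (x : 'M[R]_(state_dim Nx T, n)) (t : 'I_T.+1) :
  submxcol (hatA *m x) t = A *m submxcol x t.
Proof. by rewrite -{1}[x]submxcolK mul_mxdiag_mxcol mxcolK. Qed.

Lemma hatB_block n (u : 'M[R]_(input_dim Nu T, n)) (t : 'I_T) :
  submxcol (hatB *m u) (widen_ord (leqnSn T) t) = B *m submxcol u t.
Proof.
rewrite -{1}[u]submxcolK /hatB mxblockEv mxcol_mul mxcolK mul_mxrow_mxcol.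
rewrite (bigD1 t) //= eqxx big1 ?addr0 // => j jt.
by rewrite ifN ?mul0mx // eq_sym.
Qed.

Lemma ZAB_block0 n (x : 'M[R]_(state_dim Nx T, n))
    (u : 'M[R]_(input_dim Nu T, n)) :
  submxcol (ZAB *m col_mx x u) ord0 = submxcol x ord0.
Proof.
rewrite /ZAB mul_row_col mulmxBl mul1mx mulNmx -!mulmxA.
by rewrite !submxcolB !downshift_block0 !subr0.
Qed.

Lemma ZAB_blockS n (x : 'M[R]_(state_dim Nx T, n))
    (u : 'M[R]_(input_dim Nu T, n)) (t : 'I_T) :
  submxcol (ZAB *m col_mx x u) (lift ord0 t) =
  submxcol x (lift ord0 t) - A *m submxcol x (widen_ord (leqnSn T) t)
  - B *m submxcol u t.
Proof.
rewrite /ZAB mul_row_col mulmxBl mul1mx mulNmx -!mulmxA.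
by rewrite !submxcolB !downshift_blockS hatA_block hatB_block.
Qed.

End LocalizedMPC.

(* Main.v *)
Require Import Defs.
From HB Require Import structures.
From mathcomp Require Import all_boot all_order all_algebra.
From mathcomp Require Import all_classical all_reals all_analysis.
Set Implicit Arguments.
Unset Strict Implicit.
Unset Printing Implicit Defensive.
Import Order.TTheory GRing.Theory Num.Theory.
Import numFieldNormedType.Exports.
Local Open Scope classical_set_scope.
Local Open Scope ring_scope.

(* Fix a localized Phi0 with ZAB Phi0 = I0. For any globally feasible Phi, the
   vector (Phi - Phi0) x0 lies in ker ZAB, a space of dimension Nu T since a
   trajectory starting at 0 is determined by its inputs. The vectors D x0, with
   D localized and ZAB D = 0, form a subspace of ker ZAB, which the rank
   condition forces to be all of it. Hence (Phi - Phi0) x0 = D x0 for such a D,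
   and Phi0 + D is localized and produces the same trajectory as Phi. *)

Lemma unitmx_ker0 (F : fieldType) n (M : 'M[F]_n) :
  (forall v : 'cV_n, M *m v = 0 -> v = 0) -> M \in unitmx.
Proof.
(* [kermx] is a left kernel; the column kernel of [M] is, up to transposition, the left kernel of
   [M^T]. *)
move=> M0; rewrite -unitmx_tr -row_free_unit -kermx_eq0.
apply/eqP/row_matrixP => i; rewrite row0.
have /sub_kermxP vM := row_sub i (kermx M^T).
apply: trmx_inj; rewrite trmx0; apply: M0; apply: trmx_inj.
by rewrite trmx_mul trmxK vM trmx0.
Qed.

Lemma mulmx_cV_eq0 (R : pzSemiRingType) m n (M : 'M[R]_(m, n)) :
  (forall v : 'cV_n, M *m v = 0) -> M = 0.
Proof.
move=> M0; apply/matrixP => i j.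
by have /colP/(_ i) := M0 (delta_mx j 0); rewrite -colE !mxE.
Qed.

Section Support.
Variable R : realType.

Lemma vec_surj m n (v : 'cV[R]_(\sum_(j < n) m)) :
  exists P : 'M[R]_(m, n), vec P = v.
Proof.
exists (\matrix_(i, j) submxcol v j i 0).
rewrite -[RHS]submxcolK; apply: eq_mxcol => j.
by apply/colP => i; rewrite !mxE.
Qed.

Lemma vec_eq0 m n (P : 'M[R]_(m, n)) : vec P = 0 -> P = 0.
Proof.
move=> vP; apply/matrixP => i j.
have := congr1 (fun v => submxcol v j) vP.
by rewrite mxcolK submxcol0 => /colP/(_ i); rewrite !mxE.
Qed.

(** Writing column selection as a product lets the selector act on the vector instead, which it
    extends by zero off [C]. *)
Lemma cols_inE m n (C : {set 'I_n}) (M : 'M[R]_(m, n)) :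
  cols_in C M = M *m cols_in C 1%:M.
Proof. by rewrite /cols_in mulmx_colsub mulmx1. Qed.

Lemma cols_in1_notin n (C : {set 'I_n}) (w : 'cV[R]_#|C|) (k : 'I_n) :
  k \notin C -> (cols_in C 1%:M *m w) k 0 = 0.
Proof.
move=> kC; rewrite mxE big1 // => j _; rewrite !mxE.
by case: eqP => [kE|_]; [rewrite kE enum_valP in kC | rewrite mul0r].
Qed.

(** A position outside [S] vanishes in every localized matrix, so its index lies outside the
    support, where the extension of [w] by zero vanishes as well. *)
Lemma support_vec m n (S : {set 'I_m * 'I_n})
    (w : 'cV[R]_#|support_idx (sparse S : set 'M[R]_(m, n))|) :
  exists2 P : 'M[R]_(m, n), sparse S P
    & vec P = cols_in (support_idx (sparse S)) 1%:M *m w.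
Proof.
have [P vP] := vec_surj (cols_in (support_idx (sparse S)) 1%:M *m w).
exists P => // i j ijS.
(* [tagnat.Rank j i] is the index of the entry [(i, j)] in the column-stacked vector. *)
have vE (Q : 'M[R]_(m, n)) :
    Q i j = vec Q (tagnat.Rank j i) 0.
  by have := congr1 (fun v : 'cV_m => v i 0) (mxcolK (fun j => col j Q) j); rewrite !mxE.
rewrite vE vP cols_in1_notin // inE; apply/asboolPn => -[Q SQ].
by rewrite -vE SQ ?eqxx.
Qed.

Lemma mul_mp_pinv_proj m n (M : 'M[R]_(m, n)) :
  M *m (1%:M - mp_pinv M *m M) = 0.
Proof.
have [MPM _ _ _] := penrose_mp_pinv M.
by rewrite mulmxBr mulmx1 mulmxA MPM subrr.
Qed.

End Support.

Section Dynamics.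
Variables (R : realType) (Nx Nu T : nat).
Variables (A : 'M[R]_Nx) (B : 'M[R]_(Nx, Nu)).

(** A kernel vector is a trajectory with zero input starting at 0, so its blocks vanish one after
    the other. *)
Lemma state_map_unit : 1%:M - downshift R Nx T *m hatA T A \in unitmx.
Proof.
apply: unitmx_ker0 => x x0.
have Zx : ZAB T A B *m col_mx x 0 = 0 by rewrite mul_row_col mulmx0 addr0.
rewrite -[x]submxcolK -[RHS]submxcolK; apply: eq_mxcol => -[t tT].
rewrite submxcol0; elim: t tT => [|t IH] tT.
  have := congr1 (fun v => submxcol v ord0) Zx.
  by rewrite ZAB_block0 submxcol0 => <-; congr submxcol; apply: val_inj.
have tT' : (t < T)%N by [].
have := congr1 (fun v => submxcol v (lift ord0 (Ordinal tT'))) Zx.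
rewrite ZAB_blockS !submxcol0 mulmx0 subr0.
rewrite [widen_ord _ _](_ : _ = Ordinal (ltnW tT)); last exact: val_inj.
rewrite IH mulmx0 subr0 => <-; congr submxcol; exact: val_inj.
Qed.

(* [I - Z hatA] is unitriangular, so the inputs determine the whole trajectory. *)
Lemma ZAB_ker_input : exists G : 'M[R]_(state_dim Nx T, input_dim Nu T),
  forall n (W : 'M[R]_(phi_dim Nx Nu T, n)),
    ZAB T A B *m W = 0 -> W = col_mx G 1%:M *m dsubmx W.
Proof.
exists (invmx (1%:M - downshift R Nx T *m hatA T A)
        *m (downshift R Nx T *m hatB T B)) => n W.
rewrite -{1 2}[W]vsubmxK mul_row_col mulNmx => /eqP; rewrite subr_eq0 => /eqP ZW.
rewrite mul_col_mx mul1mx -mulmxA -ZW mulmxA mulVmx ?mul1mx //.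
exact: state_map_unit.
Qed.

End Dynamics.

Lemma localized_kernel_onto (R : realType) (Nx Nu T : nat)
    (A : 'M[R]_Nx) (B : 'M[R]_(Nx, Nu))
    (S : {set 'I_(phi_dim Nx Nu T) * 'I_Nx}) (x0 : 'cV[R]_Nx) :
  let M := support_idx (sparse S) in
  let H := Hmat A B (sparse S) in
  \rank (cols_in M (X2 Nu T x0) *m (1%:M - mp_pinv H *m H)) = (Nu * T)%N ->
  forall d : 'cV[R]_(phi_dim Nx Nu T), ZAB T A B *m d = 0 ->
  exists D : 'M[R]_(phi_dim Nx Nu T, Nx),
    [/\ sparse S D, ZAB T A B *m D = 0 & D *m x0 = d].
Proof.
move=> M H rkNuT d Zd.
set K := 1%:M - mp_pinv H *m H in rkNuT.
pose W := cols_in M (Xmat Nu T x0) *m K.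
(* Since [H *m K = 0], the vector [K *m w], extended by zero off the support, is [vec D] for a
   localized [D] killed by [ZAB]. *)
have Wlift w : exists D : 'M[R]_(phi_dim Nx Nu T, Nx),
    [/\ sparse S D, ZAB T A B *m D = 0 & D *m x0 = W *m w].
  have [D SD vD] := support_vec (S := S) (K *m w); exists D; split => //.
    apply: vec_eq0; rewrite -blkdiag_vec vD mulmxA -cols_inE.
    by rewrite mulmxA mul_mp_pinv_proj mul0mx.
  by rewrite -Xmat_vec vD mulmxA -cols_inE /W -!mulmxA.
have ZW : ZAB T A B *m W = 0.
  apply: mulmx_cV_eq0 => w; rewrite -mulmxA.
  by have [D [_ ZD <-]] := Wlift w; rewrite mulmxA ZD mul0mx.
have [G ZG] := ZAB_ker_input T A B.
(* The columns of [W] are determined by their input parts, so [dsubmx W] has at least the rank of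
   [W]. That rank is at least the rank [Nu * T] of [rows_from Nx W], and [dsubmx W] has exactly
   [Nu * T] rows. *)
have fullWu : row_free (dsubmx W).
  rewrite /row_free eqn_leq rank_leq_row /=.
  apply: (@leq_trans (Nu * T)); first by rewrite sum_nat_const card_ord mulnC.
  have X2W : cols_in M (X2 Nu T x0) *m K = rows_from Nx W.
    rewrite /rows_from /W -mul_rowsub_mx; congr (_ *m _).
    by apply/matrixP => i j; rewrite !mxE.
  rewrite -rkNuT X2W; apply: (@leq_trans (\rank W)).
    exact/mxrankS/rowsub_sub.
  by rewrite [W in leqLHS](ZG _ _ ZW) mxrankM_maxr.
(* A right inverse of [dsubmx W] yields a [w] that reproduces the inputs of [d]. *)
have [w Ww] : exists w, dsubmx W *m w = dsubmx d.
  by have /row_freeP[V WV] := fullWu; exists (V *m dsubmx d); rewrite mulmxA WV mul1mx.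
have [D [SD ZD DW]] := Wlift w; exists D; split => //.
(* [W *m w] and [d] both lie in the kernel of [ZAB] and share their inputs, so they coincide. *)
by rewrite DW (ZG _ _ ZW) (ZG _ _ Zd) -Ww mulmxA.
Qed.

Theorem theorem3 (R : realType) (Nx Nu T : nat)
  (Nx_gt0 : (0 < Nx)%N) (Nu_gt0 : (0 < Nu)%N) (T_gt0 : (0 < T)%N)
  (A : 'M[R]_Nx) (B : 'M[R]_(Nx, Nu))
  (S : {set 'I_(phi_dim Nx Nu T) * 'I_Nx})
  (ft : 'I_T -> 'cV[R]_Nx * 'cV[R]_Nu -> \bar R) (fT : 'cV[R]_Nx -> \bar R)
  (ft_cpc : forall t, closed_proper_convex (ft t))
  (fT_cpc : closed_proper_convex fT)
  (ft_min : forall t, min_at_origin (ft t)) (fT_min : min_at_origin fT)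
  (XX : 'I_T.+1 -> set 'cV[R]_Nx) (UU : 'I_T -> set 'cV[R]_Nu)
  (XX_closed : forall t, closed (XX t)) (UU_closed : forall t, closed (UU t))
  (XX_convex : forall t, convex_set (XX t))
  (UU_convex : forall t, convex_set (UU t))
  (XX_0 : forall t, XX t 0) (UU_0 : forall t, UU t 0)
  (x0 : 'cV[R]_Nx) (x0_neq0 : exists i, x0 i 0 != 0)
  (local_feasible : exists Phi : 'M[R]_(phi_dim Nx Nu T, Nx),
     ZAB T A B *m Phi = I0 R Nx T /\ sparse S Phi)
  (local_rank :
     let M := support_idx (sparse S) in
     let H := Hmat A B (sparse S) in
     \rank (cols_in M (X2 Nu T x0) *m (1%:M - mp_pinv H *m H)) = (Nu * T)%N) :
  mpc_value A B ft fT XX UU x0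
  = localized_mpc_value A B ft fT XX UU (sparse S) x0.
Proof.
have [Phi0 [ZPhi0 SPhi0]] := local_feasible.
rewrite /mpc_value /localized_mpc_value; congr ereal_inf.
(* The two sets of attained costs are equal; localized costs are global ones at once, and the
   converse replaces [Phi] by [Phi0 + D]. *)
apply/seteqP; split => [_ [Phi [ZPhi xXX uUU] <-]|_ [Phi [fPhi _] <-]]; last first.
  by exists Phi.
have [|D [SD ZD DE]] := localized_kernel_onto local_rank (d := (Phi - Phi0) *m x0).
  by rewrite mulmxA mulmxBr ZPhi ZPhi0 subrr mul0mx.
have E : (Phi0 + D) *m x0 = Phi *m x0.
  by rewrite mulmxDl DE mulmxBl addrC subrK.
have [Eu Ed] : usubmx (Phi0 + D) *m x0 = usubmx Phi *m x0
    /\ dsubmx (Phi0 + D) *m x0 = dsubmx Phi *m x0.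
  by rewrite !mul_usub_mx !mul_dsub_mx E.
exists (Phi0 + D); last by rewrite Eu Ed.
split; last by move=> i j ijS; rewrite mxE SPhi0 // SD // addr0.
by split; rewrite ?Eu ?Ed // mulmxDr ZPhi0 ZD addr0.
Qed.
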